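(* Let $a(n)=a_{1+x+x^2,2}(n)$ be the number of accessible $n$-blocks for the polynomial $1+x+x^2$ modulo $2$. Then, as formal power series in $z$, $$\sum_{n=0}^{\infty}a(n)z^n=\frac{1+2z^3+2z^5-z^6+z^3\sum_{i=0}^{\infty}\big(z^{2^i}-z^{3\cdot 2^i}\big)}{(1-z^2)(1-z)^2}.$$
   Context: For a prime $p$ and a polynomial $f(x)$ with integer coefficients, ''row $i$'' is the string of coefficients of $f(x)^i$ reduced modulo $p$, ordered by increasing powers of $x$ (from $x^0$ up to $x^{\deg f^i}$). An $m$-block is a string of $m$ residues modulo $p$; it is accessible if it occurs as a substring of consecutive entries of row $i$ for some $i\ge0$. $a_{f,p}(m)$ is the number of accessible $m$-blocks, with the convention $a_{f,p}(0)=1$. *)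

(* Defs.v *)
From HB Require Import structures.
From mathcomp Require Import all_boot all_order all_algebra.
From mathcomp Require Import boolp classical_sets functions cardinality fsbigop.

Set Implicit Arguments.
Unset Strict Implicit.
Unset Printing Implicit Defensive.

Import GRing.Theory.

Local Open Scope ring_scope.

(* 'F_p is the field of residues modulo p only for p prime. The degree of
   f ^+ i, hence the length of the row, is taken over the integers, so a row
   may end with zeros modulo p. *)
Definition row_mod (p : nat) (f : {poly int}) (i : nat) : seq 'F_p :=
  [seq (c%:~R : 'F_p) | c <- (f ^+ i : {poly int})].

Definition accessible (p : nat) (f : {poly int}) (m : nat)
    (b : m.-tuple 'F_p) : Prop :=
  exists i : nat, infix b (row_mod p f i).

Definition nb_accessible (p : nat) (f : {poly int}) (m : nat) : nat :=
  #|[set b : m.-tuple 'F_p | `[< accessible f b >]]|.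

Lemma nb_accessible0 (p : nat) (f : {poly int}) : nb_accessible p f 0 = 1%N.
Proof.
rewrite /nb_accessible (_ : [set b | _] = [set [tuple]])%SET ?cards1 //.
apply/setP => b; rewrite !inE [b]tuple0 eqxx; apply/asboolP.
by exists 0%N; rewrite infix0s.
Qed.

(* Wrapping the coefficients in a record keeps the Cauchy product apart from
   the pointwise product that [nat -> R] already carries. *)
Record fps (R : Type) := Fps { fps_coef :> nat -> R }.

Lemma fpsP (R : Type) (f g : fps R) : (forall n, f n = g n) -> f = g.
Proof. by case: f g => [f] [g] /= fg; congr Fps; apply/funext. Qed.

HB.instance Definition _ (R : Type) := gen_eqMixin (fps R).
HB.instance Definition _ (R : Type) := gen_choiceMixin (fps R).

Definition fps_zero (R : zmodType) : fps R := Fps (fun=> 0).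
Definition fps_opp (R : zmodType) (f : fps R) : fps R := Fps (fun n => - f n).
Definition fps_add (R : zmodType) (f g : fps R) : fps R :=
  Fps (fun n => f n + g n).

Fact fps_addA (R : zmodType) : associative (@fps_add R).
Proof. by move=> f g h; apply: fpsP => n /=; rewrite addrA. Qed.
Fact fps_addC (R : zmodType) : commutative (@fps_add R).
Proof. by move=> f g; apply: fpsP => n /=; rewrite addrC. Qed.
Fact fps_add0 (R : zmodType) : left_id (@fps_zero R) (@fps_add R).
Proof. by move=> f; apply: fpsP => n /=; rewrite add0r. Qed.
Fact fps_addN (R : zmodType) :
  left_inverse (@fps_zero R) (@fps_opp R) (@fps_add R).
Proof. by move=> f; apply: fpsP => n /=; rewrite addNr. Qed.

HB.instance Definition _ (R : zmodType) := GRing.isZmodule.Build (fps R)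
  (@fps_addA R) (@fps_addC R) (@fps_add0 R) (@fps_addN R).

Definition fps_one (R : comNzRingType) : fps R := Fps (fun n => (n == 0%N)%:R).
Definition fps_mul (R : comNzRingType) (f g : fps R) : fps R :=
  Fps (fun n => \sum_(i < n.+1) f i * g (n - i)%N).

Definition fps_trunc (R : comNzRingType) (n : nat) (f : fps R) : {poly R} :=
  \poly_(i < n.+1) f i.

Lemma coef_fps_trunc (R : comNzRingType) (n : nat) (f : fps R) (k : nat) :
  (k <= n)%N -> (fps_trunc n f)`_k = f k.
Proof. by move=> kn; rewrite coef_poly ltnS kn. Qed.

Lemma fps_mul_trunc (R : comNzRingType) (n : nat) (f g : fps R) (k : nat) :
  (k <= n)%N -> fps_mul f g k = (fps_trunc n f * fps_trunc n g)`_k.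
Proof.
move=> kn; rewrite coefM; apply: eq_bigr => -[i /=]; rewrite ltnS => ik _.
by rewrite !coef_fps_trunc // ?(leq_trans (leq_subr _ _)) ?(leq_trans ik).
Qed.

Fact fps_mulC (R : comNzRingType) : commutative (@fps_mul R).
Proof.
by move=> f g; apply: fpsP => n; rewrite !(@fps_mul_trunc _ n) // mulrC.
Qed.
Fact fps_mulA (R : comNzRingType) : associative (@fps_mul R).
Proof.
have E (f g h : fps R) n : fps_mul (fps_mul f g) h n =
    (fps_trunc n f * fps_trunc n g * fps_trunc n h)`_n.
  rewrite coefM; apply: eq_bigr => -[i /=]; rewrite ltnS => ik _.
  by rewrite -fps_mul_trunc // coef_fps_trunc ?leq_subr.
move=> f g h; apply: fpsP => n.
by rewrite fps_mulC !E mulrC mulrA.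
Qed.
Fact fps_mul1 (R : comNzRingType) : left_id (@fps_one R) (@fps_mul R).
Proof.
move=> f; apply: fpsP => n /=; rewrite big_ord_recl /= mul1r subn0.
by rewrite big1 ?addr0 // => i _; rewrite mul0r.
Qed.
Fact fps_mulDl (R : comNzRingType) : left_distributive (@fps_mul R) +%R.
Proof.
move=> f g h; apply: fpsP => n /=; rewrite -big_split /=.
by apply: eq_bigr => i _; rewrite mulrDl.
Qed.
Fact fps_oner_neq0 (R : comNzRingType) : fps_one R != 0.
Proof.
apply/eqP => /(congr1 (fun f : fps R => f 0%N)) /= /eqP.
by rewrite oner_eq0.
Qed.

HB.instance Definition _ (R : comNzRingType) :=
  GRing.Zmodule_isComNzRing.Build (fps R) (@fps_mulA R) (@fps_mulC R)
    (@fps_mul1 R) (@fps_mulDl R) (@fps_oner_neq0 R).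

Lemma fps_coefM (R : comNzRingType) (f g : fps R) (n : nat) :
  (f * g) n = \sum_(i < n.+1) f i * g (n - i)%N.
Proof. by []. Qed.

(* The first n coefficients of the inverse g of f, from f_0 g_0 = 1 and
   sum_(k <= m) g_k f_(m - k) = 0 for m > 0. *)
Fixpoint fps_inv_take (R : comUnitRingType) (f : fps R) (n : nat) : seq R :=
  if n is m.+1 then
    let s := fps_inv_take f m in
    rcons s ((f 0%N)^-1 * ((m == 0%N)%:R - \sum_(k < m) s`_k * f (m - k)%N))
  else [::].

Definition fps_unit (R : comUnitRingType) : pred (fps R) :=
  [pred f : fps R | f 0%N \is a GRing.unit].

Definition fps_inv (R : comUnitRingType) (f : fps R) : fps R :=
  if fps_unit f then Fps (fun n => (fps_inv_take f n.+1)`_n) else f.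

Lemma size_fps_inv_take (R : comUnitRingType) (f : fps R) (n : nat) :
  size (fps_inv_take f n) = n.
Proof. by elim: n => //= n IHn; rewrite size_rcons IHn. Qed.

Lemma nth_fps_inv_take (R : comUnitRingType) (f : fps R) (n k : nat) :
  (k < n)%N -> (fps_inv_take f n)`_k = (fps_inv_take f k.+1)`_k.
Proof.
elim: n => // n IHn; rewrite ltnS leq_eqVlt => /predU1P[-> //|kn].
by rewrite [LHS]/= nth_rcons size_fps_inv_take kn IHn.
Qed.

Lemma fps_inv_rec (R : comUnitRingType) (f : fps R) (n : nat) : fps_unit f ->
  fps_inv f n =
    (f 0%N)^-1 * ((n == 0%N)%:R - \sum_(k < n) fps_inv f k * f (n - k)%N).
Proof.
move=> uf; rewrite /fps_inv uf /= nth_rcons size_fps_inv_take ltnn eqxx.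
congr (_ * (_ - _)); apply: eq_bigr => k _; congr (_ * _).
exact: nth_fps_inv_take (ltn_ord k).
Qed.

Fact fps_mulVf (R : comUnitRingType) :
  {in @fps_unit R, left_inverse 1 (@fps_inv R) *%R}.
Proof.
move=> f uf; apply: fpsP => n; have := fps_inv_rec n uf.
move: (fps_inv f) => g gn; rewrite fps_coefM big_ord_recr /= subnn gn.
by rewrite mulrAC mulVr // mul1r addrC subrK.
Qed.

Fact fps_unitPl (R : comUnitRingType) (f g : fps R) :
  g * f = 1 -> fps_unit f.
Proof.
move=> /(congr1 (fun h : fps R => h 0%N)); rewrite fps_coefM big_ord1 subn0.
by move=> gf1; apply/unitrPr; exists (g 0%N); rewrite mulrC.
Qed.

Fact fps_inv_out (R : comUnitRingType) :
  {in [predC @fps_unit R], @fps_inv R =1 id}.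
Proof. by move=> f nuf; rewrite /fps_inv ifN. Qed.

HB.instance Definition _ (R : comUnitRingType) :=
  GRing.ComNzRing_hasMulInverse.Build (fps R)
    (@fps_mulVf R) (@fps_unitPl R) (@fps_inv_out R).

Lemma fps_unitE (R : comUnitRingType) (f : fps R) :
  (f \is a GRing.unit) = (f 0%N \is a GRing.unit).
Proof. by []. Qed.

Definition fps_z (R : comNzRingType) : fps R := Fps (fun n => (n == 1%N)%:R).

Lemma fps_coefXn (R : comNzRingType) (k n : nat) :
  (fps_z R ^+ k) n = (n == k)%:R.
Proof.
elim: k n => [//|k IHk] n; rewrite exprS fps_coefM.
case: n => [|n]; first by rewrite big_ord1 mul0r.
rewrite big_ord_recl mul0r add0r big_ord_recl mul1r /= IHk subn1 /=.
by rewrite big1 ?addr0 // => i _; rewrite mul0r.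
Qed.

(* Sum of a family of power series in which each power of z occurs in only
   finitely many members; a coefficient for which this fails is set to 0. *)
Definition fps_sum (R : zmodType) (u : nat -> fps R) : fps R :=
  Fps (fun n => \sum_(i \in [set: nat]%classic) u i n).

Lemma fps_sumE (R : zmodType) (u : nat -> fps R) (n N : nat) :
  (forall i, (N <= i)%N -> u i n = 0) -> fps_sum u n = \sum_(i < N) u i n.
Proof.
move=> uN; rewrite /= -(@fsbig_widen _ _ _ _ `I_N) -?fsbig_ord //.
by move=> i [_ /= /negP]; rewrite -leqNgt => /uN.
Qed.

Lemma fps_sum_pow2E (R : comNzRingType) (n : nat) :
  fps_sum (fun i => fps_z R ^+ (2 ^ i) - fps_z R ^+ (3 * 2 ^ i)) n =
  \sum_(i < n.+1) ((n == (2 ^ i)%N)%:R - (n == (3 * 2 ^ i)%N)%:R).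
Proof.
rewrite (@fps_sumE _ _ n n.+1) => [|i ni].
  by apply: eq_bigr => i _; rewrite -!fps_coefXn.
have n2 : (n < 2 ^ i)%N by apply: leq_trans ni (ltnW (ltn_expl _ _)).
rewrite -[LHS]/((fps_z R ^+ _) n - (fps_z R ^+ _) n) !fps_coefXn.
by rewrite !ltn_eqF ?subrr //; apply: leq_trans n2 (leq_pmull _ _).
Qed.

(* Main.v *)
(* Modulo 2, with f = 1 + x + x^2, one has f^(2i)(x) = f^i(x^2), and f^(2i+1) is
   f times this. So a block of an even row interleaves a block of row i with
   zeros, a block of an odd row interleaves a block of row i with the sums of
   its neighbouring entries, and the parity of the starting point decides which
   comes first. Each of the four constructions is injective. For m >= 6 they
   overlap only in the zero block, 10...0, 0...01 and the three nonzero blocks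
   of period 3, which gives
     a(m) = a(ceil(m/2)) + a(floor(m/2)) + a(ceil(m/2)+1) + a(floor(m/2)+1) - 8.
   The denominator of the generating function is 1 - 2z + 2z^3 - z^4. For
   c(n) = a(n+4) - 2a(n+3) + 2a(n+1) - a(n) the recursion becomes c(2k) = 0 and
   c(2k+1) = c(k) when k >= 3, which is also how the coefficient of z^(n+1) in
   the sum of the z^(2^i) - z^(3*2^i) behaves. *)
Require Import Defs.
From HB Require Import structures.
From mathcomp Require Import all_boot all_order all_algebra.
From mathcomp Require Import boolp ring zify.

Set Implicit Arguments.
Unset Strict Implicit.
Unset Printing Implicit Defensive.

Import GRing.Theory.
Local Open Scope ring_scope.

(** * Arithmetic and squaring of polynomials over the field with two elements *)

Lemma F2P (x : 'F_2) : x = 0 \/ x = 1.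
Proof. by case: x => -[|[|//]] i; [left|right]; apply: val_inj. Qed.

Lemma F2_addxx (x : 'F_2) : x + x = 0.
Proof. by case: (F2P x) => ->; apply: val_inj. Qed.

Lemma F2_addKl (x y : 'F_2) : x + (x + y) = y.
Proof. by rewrite addrA F2_addxx add0r. Qed.

Lemma F2_addKr (x y : 'F_2) : x + y + y = x.
Proof. by rewrite -addrA F2_addxx addr0. Qed.

Lemma F2_add_eq0 (x y : 'F_2) : x + y = 0 -> x = y.
Proof. by move=> xy; rewrite -[x](F2_addKr _ y) xy add0r. Qed.

Lemma F2_polyDxx (p : {poly 'F_2}) : p + p = 0.
Proof. by apply/polyP => i; rewrite coefD F2_addxx coef0. Qed.

Lemma F2_poly_sqrD (p q : {poly 'F_2}) : (p + q) ^+ 2 = p ^+ 2 + q ^+ 2.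
Proof. by rewrite sqrrD mulr2n F2_polyDxx addr0. Qed.

(** Frobenius: over the field with two elements, p(x)^2 = p(x^2). *)
Lemma F2_coef_sqr (p : {poly 'F_2}) (n : nat) :
  (p ^+ 2)`_n = if odd n then 0 else p`_n./2.
Proof.
elim/poly_ind: p n => [|p c IHp] n; first by rewrite expr0n !coef0 if_same.
rewrite F2_poly_sqrD exprMn coefD coefMXn IHp -polyC_exp !coefD !coefC coefMX.
have -> : c ^+ 2 = c by case: (F2P c) => ->; rewrite ?expr1n // expr0n.
by case: n => [|[|n]] /=; rewrite ?add0r ?addr0 ?subSS ?subn0 ?negbK.
Qed.

(** * Rows of the powers of the trinomial and windows in them *)

Definition trinom : {poly 'F_2} := 1 + 'X + 'X^2.

Definition tricoef (i n : nat) : 'F_2 := (trinom ^+ i)`_n.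

Lemma tricoef0 (n : nat) : tricoef 0 n = (n == 0%N)%:R.
Proof. by rewrite /tricoef expr0 coef1. Qed.

Lemma tricoef_double (i n : nat) :
  tricoef i.*2 n = if odd n then 0 else tricoef i n./2.
Proof. by rewrite /tricoef -muln2 exprM F2_coef_sqr. Qed.

(** The bound keeps away from n = 0, where the truncated [n./2.-1] would count the constant
    coefficient twice. *)
Lemma tricoef_doubleS (i n : nat) : (1 < n)%N ->
  tricoef i.*2.+1 n =
    if odd n then tricoef i n./2 else tricoef i n./2.-1 + tricoef i n./2.
Proof.
case: n => [|[|n]] // _; rewrite /tricoef exprSr -muln2 exprM.
rewrite !mulrDr mulr1 !coefD coefMX coefMXn !F2_coef_sqr /=.
rewrite !subSS subn0 /= negbK uphalf_half.
by case: odd => /=; rewrite ?addr0 ?add0r // addrC.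
Qed.

Lemma size_trinom_exp (i : nat) : (size (trinom ^+ i) <= i.*2.+1)%N.
Proof.
apply: leq_trans (size_poly_exp_leq _ _) _.
have /leP : (size trinom <= 3)%N.
  apply/leq_sizeP => -[|[|[|j]]] // _.
  by rewrite !coefD coef1 coefX coefXn !addr0.
by move=> ?; rewrite ltnS -mul2n leq_mul2r; apply/orP; right; lia.
Qed.

Lemma trinom_pow2 (e : nat) :
  trinom ^+ (2 ^ e) = 1 + 'X^(2 ^ e) + 'X^(2 ^ e.+1).
Proof.
elim: e => [|e IHe]; first by rewrite expr1.
by rewrite expnSr exprM IHe !F2_poly_sqrD expr1n -!exprM -!expnSr.
Qed.

(* Multiplication of row [i] by [trinom ^+ 2 ^ e], for large [e], yields three
   well-separated copies of it; in the middle one a window may overlap the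
   zeros on either side. *)
Lemma tricoef_embed (i s m : nat) : exists i' s',
  [/\ (1 < s')%N, (s' + m <= i'.*2.+1)%N &
      forall k, (k < m)%N -> tricoef i' (s' + k) = tricoef i (s + k)].
Proof.
(* Since 2^K > K, the first copy of row [i] ends before position 2^K, and the third starts at
   2^(K+1), beyond the end of the window. *)
pose K := (i.*2 + s + m).+2; have := ltn_expl K (isT : 1 < 2)%N => KE.
exists (i + 2 ^ K)%N, (2 ^ K + s)%N; split => [||k km].
- by lia.
- by lia.
rewrite /tricoef exprD trinom_pow2 !mulrDr mulr1 !coefD !coefMXn expnS.
rewrite nth_default; last by apply: leq_trans (size_trinom_exp i) _; lia.
have -> : (2 ^ K + s + k < 2 ^ K)%N = false by lia.
have -> : (2 ^ K + s + k < 2 * 2 ^ K)%N by lia.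
by rewrite add0r addr0; congr (_`_ _); lia.
Qed.

(* The window may run past the end of the row, where [tricoef] is 0. *)
Definition acc (m : nat) (b : nat -> 'F_2) : Prop :=
  exists i s, forall j, (j < m)%N -> b j = tricoef i (s + j).

Lemma nth_row_mod (i n : nat) :
  (row_mod 2 (1 + 'X + 'X^2) i)`_n = tricoef i n.
Proof.
rewrite /row_mod /tricoef; set p := _ ^+ i.
have -> : trinom ^+ i = map_poly (fun c : int => c%:~R : 'F_2) p.
  by rewrite rmorphXn !rmorphD /= rmorph1 map_polyX map_polyXn.
have [np|np] := ltnP n (size p); first by rewrite (nth_map 0) // coef_map.
rewrite !nth_default ?size_map //.
by apply: leq_trans np; rewrite size_poly.
Qed.

Lemma size_row_mod (i : nat) : size (row_mod 2 (1 + 'X + 'X^2) i) = i.*2.+1.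
Proof.
rewrite size_map -[LHS]prednK.
  rewrite size_exp (_ : size _ = 3) ?mul2n //.
  rewrite addrC size_polyDl size_polyXn // addrC.
  by rewrite size_polyDl ?size_polyX ?size_poly1.
rewrite lt0n size_poly_eq0 expf_neq0 //; apply/eqP.
move=> /(congr1 (fun p : {poly int} => p`_0)).
by rewrite !coefD coef1 coefX coefXn coef0.
Qed.

(** A window of [acc] that overruns its row is moved by [tricoef_embed] into the interior of another
    row, where it is a genuine infix. *)
Lemma accessibleE (m : nat) (b : m.-tuple 'F_2) :
  accessible (1 + 'X + 'X^2) b <-> acc m (nth 0 b).
Proof.
split=> [[i /infixP[u [v rowE]]]|[i [s bE]]].
  exists i, (size u) => j jm.
  rewrite -nth_row_mod rowE nth_cat ltnNge leq_addr addKn nth_cat.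
  by rewrite size_tuple jm.
have [i' [s' [_ s'i' bE']]] := tricoef_embed i s m.
exists i'; set row := row_mod _ _ _.
suff <- : take m (drop s' row) = b.
  by apply: infix_trans (infix_take _ _) (infix_drop _ _).
have sz : size (take m (drop s' row)) = m.
  by rewrite size_takel // size_drop size_row_mod; lia.
apply: (@eq_from_nth _ 0); rewrite sz ?size_tuple // => j jm.
by rewrite nth_take // nth_drop nth_row_mod bE' // bE.
Qed.

Lemma acc_eq (m : nat) (b c : nat -> 'F_2) :
  (forall j, (j < m)%N -> b j = c j) -> acc m b -> acc m c.
Proof. by move=> bc [i [s bE]]; exists i, s => j jm; rewrite -bc ?bE. Qed.

Lemma acc_leq (m n : nat) (b : nat -> 'F_2) : (m <= n)%N -> acc n b -> acc m b.
Proof.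
by move=> mn [i [s bE]]; exists i, s => j jm; apply/bE/(leq_trans jm).
Qed.

(** * The four interleavings and their injectivity *)

Definition zip0r (w : nat -> 'F_2) (j : nat) : 'F_2 :=
  if odd j then 0 else w j./2.
Definition zip0l (w : nat -> 'F_2) (j : nat) : 'F_2 :=
  if odd j then w j./2 else 0.
Definition zipDl (w : nat -> 'F_2) (j : nat) : 'F_2 :=
  if odd j then w j./2.+1 else w j./2 + w j./2.+1.
Definition zipDr (w : nat -> 'F_2) (j : nat) : 'F_2 :=
  if odd j then w j./2 + w j./2.+1 else w j./2.

Definition acc_by (op : (nat -> 'F_2) -> nat -> 'F_2) (n m : nat)
    (b : nat -> 'F_2) : Prop :=
  exists2 w, acc n w & forall j, (j < m)%N -> b j = op w j.

(** The digit 0 stands for even rows (inserted zeros), D for odd rows (inserted sums); l and r tell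
    whether the inserted entries take the even or the odd positions of the block. *)
Lemma accP (m : nat) (b : nat -> 'F_2) : acc m b <->
  [\/ acc_by zip0r (uphalf m) m b, acc_by zip0l m./2 m b,
      acc_by zipDl (uphalf m).+1 m b | acc_by zipDr m./2.+1 m b].
Proof.
split.
  (* The window is first moved to start at [s] > 1, as [tricoef_doubleS] and the predecessor of
     [s./2] require. *)
  case=> i0 [s0 bE0]; have [i [s [s1 _ bE]]] := tricoef_embed i0 s0 m.
  have {i0 s0 bE0} bE j : (j < m)%N -> b j = tricoef i (s + j).
    by move=> jm; rewrite bE ?bE0.
  pose w t j := tricoef i./2 (t + j).
  have accw n t : acc n (w t) by exists i./2, t.
  have [oi|ei] := boolP (odd i); have [os|es] := boolP (odd s).
  - apply: Or44; exists (w s./2) => // j jm.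
    rewrite bE // -[i]odd_double_half oi add1n tricoef_doubleS; last by lia.
    rewrite /zipDr /w oddD os.
    case: (odd j) (odd_double_half j) => /= jE; [congr (_ + _)|];
      by congr tricoef; lia.
  (* The first entry is a sum of the source entries at s/2 - 1 and s/2, so the source window starts
     one place earlier. *)
  - apply: Or43; exists (w s./2.-1) => // j jm.
    rewrite bE // -[i]odd_double_half oi add1n tricoef_doubleS; last by lia.
    rewrite /zipDl /w oddD (negbTE es).
    case: (odd j) (odd_double_half j) => /= jE; [|congr (_ + _)];
      by congr tricoef; lia.
  - apply: Or42; exists (w s./2.+1) => // j jm.
    rewrite bE // -[i]odd_double_half (negbTE ei) add0n tricoef_double.
    rewrite /zip0l /w oddD os.
    by case: (odd j) (odd_double_half j) => //= jE; congr tricoef; lia.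
  - apply: Or41; exists (w s./2) => // j jm.
    rewrite bE // -[i]odd_double_half (negbTE ei) add0n tricoef_double.
    rewrite /zip0r /w oddD (negbTE es).
    by case: (odd j) (odd_double_half j) => //= jE; congr tricoef; lia.
case=> -[w [i0 [s0 wE0]] bE];
  [have [i [s [s1 _ wE]]] := tricoef_embed i0 s0 (uphalf m)
  |have [i [s [s1 _ wE]]] := tricoef_embed i0 s0 m./2
  |have [i [s [s1 _ wE]]] := tricoef_embed i0 s0 (uphalf m).+1
  |have [i [s [s1 _ wE]]] := tricoef_embed i0 s0 m./2.+1].
- exists i.*2, s.*2 => j jm; rewrite bE // tricoef_double.
  rewrite oddD odd_double /zip0r.
  case: (odd j) (odd_double_half j) => //= jE; rewrite wE0 -?wE; try lia.
  by congr tricoef; lia.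
- exists i.*2, s.*2.-1 => j jm; rewrite bE // tricoef_double /zip0l.
  have -> : odd (s.*2.-1 + j) = ~~ odd j by lia.
  case: (odd j) (odd_double_half j) => //= jE; rewrite wE0 -?wE; try lia.
  by congr tricoef; lia.
- exists i.*2.+1, s.*2.+2 => j jm; rewrite bE // /zipDl.
  rewrite tricoef_doubleS; last by lia.
  have -> : odd (s.*2.+2 + j) = odd j by lia.
  case: (odd j) (odd_double_half j) => //= jE; rewrite !wE0 -?wE; try lia.
    by congr tricoef; lia.
  by congr (_ + _); congr tricoef; lia.
- exists i.*2.+1, s.*2.+1 => j jm; rewrite bE // /zipDr.
  rewrite tricoef_doubleS; last by lia.
  have -> : odd (s.*2.+1 + j) = ~~ odd j by lia.
  case: (odd j) (odd_double_half j) => //= jE; rewrite !wE0 -?wE; try lia.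
    by congr (_ + _); congr tricoef; lia.
  by congr tricoef; lia.
Qed.

Lemma zip0r_double w i : zip0r w i.*2 = w i.
Proof. by rewrite /zip0r odd_double doubleK. Qed.
Lemma zip0r_doubleS w i : zip0r w i.*2.+1 = 0.
Proof. by rewrite /zip0r /= odd_double. Qed.
Lemma zip0l_double w i : zip0l w i.*2 = 0.
Proof. by rewrite /zip0l odd_double. Qed.
Lemma zip0l_doubleS w i : zip0l w i.*2.+1 = w i.
Proof. by rewrite /zip0l /= odd_double uphalf_double. Qed.
Lemma zipDl_double w i : zipDl w i.*2 = w i + w i.+1.
Proof. by rewrite /zipDl odd_double doubleK. Qed.
Lemma zipDl_doubleS w i : zipDl w i.*2.+1 = w i.+1.
Proof. by rewrite /zipDl /= odd_double uphalf_double. Qed.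
Lemma zipDr_double w i : zipDr w i.*2 = w i.
Proof. by rewrite /zipDr odd_double doubleK. Qed.
Lemma zipDr_doubleS w i : zipDr w i.*2.+1 = w i + w i.+1.
Proof. by rewrite /zipDr /= odd_double uphalf_double. Qed.

Definition zipE := (zip0r_double, zip0r_doubleS, zip0l_double, zip0l_doubleS,
  zipDl_double, zipDl_doubleS, zipDr_double, zipDr_doubleS).

Variant parity_spec : nat -> Type :=
  | ParityEven i : parity_spec i.*2
  | ParityOdd i : parity_spec i.*2.+1.

Lemma parityP (n : nat) : parity_spec n.
Proof. by rewrite -(odd_double_half n); case: odd; constructor. Qed.

(** From left to right, [op] induces a map from n-blocks to m-blocks; from right to left, that map
    is injective. *)
Definition equivalid (op : (nat -> 'F_2) -> nat -> 'F_2) (n m : nat) : Prop :=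
  forall w w', (forall i, (i < n)%N -> w i = w' i) <->
               (forall j, (j < m)%N -> op w j = op w' j).

Lemma equivalid_zip0r (m : nat) : equivalid zip0r (uphalf m) m.
Proof.
move=> w w'; split=> E j jm.
  by case: (parityP j) jm => i im; rewrite !zipE ?E //; lia.
by have := E j.*2; rewrite !zipE; apply; lia.
Qed.

Lemma equivalid_zip0l (m : nat) : equivalid zip0l m./2 m.
Proof.
move=> w w'; split=> E j jm.
  by case: (parityP j) jm => i im; rewrite !zipE ?E //; lia.
by have := E j.*2.+1; rewrite !zipE; apply; lia.
Qed.

Lemma equivalid_zipDl (m : nat) : (1 < m)%N ->
  equivalid zipDl (uphalf m).+1 m.
Proof.
move=> m1 w w'; split=> E j jm.
  by case: (parityP j) jm => i im; rewrite !zipE !E //; lia.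
(* Source entry 0 is visible only in the sum at position 0; position 1 shows entry 1 and so isolates
   it. This is where 1 < m is needed. The later entries follow from the sums. *)
elim: j jm => [|i IHi] im.
  have := E 0%N (ltnW m1); have := E 1%N m1.
  rewrite !(zipDl_double _ 0) !(zipDl_doubleS _ 0).
  by move=> ->; apply: addIr.
have := E i.*2; rewrite !zipE IHi; last by lia.
by move=> /(_ _)/addrI -> //; lia.
Qed.

Lemma equivalid_zipDr (m : nat) : (0 < m)%N -> equivalid zipDr m./2.+1 m.
Proof.
move=> m0 w w'; split=> E j jm.
  by case: (parityP j) jm => i im; rewrite !zipE !E //; lia.
elim: j jm => [|i IHi] im; first exact: (E 0%N m0).
have := E i.*2.+1; rewrite !zipE IHi; last by lia.
by move=> /(_ _)/addrI -> //; lia.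
Qed.

(** * Accessible blocks: zero, a single 1 at an end, and all short ones *)

Lemma acc_zero (m : nat) : acc m (fun=> 0).
Proof. by exists 0%N, 1%N => j _; rewrite tricoef0. Qed.

Lemma acc_first (m : nat) : acc m (fun j => (j == 0%N)%:R).
Proof. by exists 0%N, 0%N => j _; rewrite tricoef0. Qed.

(** Row 0 has no zeros before its 1, so even rows are used: the block of length k yields that of
    length 2k through [zip0l], and the block of length k + 1 yields that of length 2k + 1 through
    [zip0r]. *)
Lemma acc_last (m : nat) : acc m (fun j => (j.+1 == m)%:R).
Proof.
elim/ltn_ind: m => m IHm; have [m1|m1] := leqP m 1.
  by apply: acc_eq (acc_first m) => j jm; congr (_%:R); lia.
case: (parityP m) m1 IHm => k k0 IHk; apply/accP.
  apply: Or42; exists (fun j => (j.+1 == k)%:R).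
    by rewrite doubleK; apply: IHk; lia.
  move=> j jk; case: (parityP j) jk => i ik; rewrite zipE.
    by have -> : (i.*2.+1 == k.*2) = false by lia.
  by congr (_%:R); lia.
apply: Or41; exists (fun j => (j.+1 == k.+1)%:R).
  by rewrite /= doubleK; apply: IHk; lia.
move=> j jk; case: (parityP j) jk => i ik; rewrite zipE.
  by congr (_%:R); lia.
by have -> : (i.*2.+2 == k.*2.+1) = false by lia.
Qed.

Lemma acc1 (b : nat -> 'F_2) : acc 1 b.
Proof.
by have [b0|b0] := F2P (b 0%N);
   [apply: acc_eq (acc_zero 1)|apply: acc_eq (acc_first 1)]; case.
Qed.

Lemma acc2 (b : nat -> 'F_2) : acc 2 b.
Proof.
have [b0|b0] := F2P (b 0%N).
  by apply/accP/Or42; exists (fun=> b 1%N); [exact: acc1 | case=> [|[]]].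
have [b1|b1] := F2P (b 1%N).
  by apply/accP/Or41; exists b; [exact: acc1 | case=> [|[]]].
apply/accP/Or44; exists (fun j => (j == 0%N)%:R); first exact: acc_first.
by case=> [|[]] //= _; rewrite ?b0 ?b1 /zipDr /= ?addr0.
Qed.

Lemma acc_le3 (m : nat) (b : nat -> 'F_2) : (m <= 3)%N -> acc m b.
Proof.
move=> m3; apply: acc_leq m3 _.
pose w j := b j.*2.
have [b1|b1] := F2P (b 1%N).
  by apply/accP/Or41; exists w; [exact: acc2 | case=> [|[|[]]]].
have [b0|b0] := F2P (b 0%N); have [b2|b2] := F2P (b 2).
- by apply/accP/Or42; exists (fun=> 1); [exact: acc1 | case=> [|[|[]]]].
- apply/accP/Or44; exists w; first exact: acc2.
  by case=> [|[|[]]] //= _; rewrite b1 /zipDr /w /= b0 b2 add0r.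
- apply/accP/Or44; exists w; first exact: acc2.
  by case=> [|[|[]]] //= _; rewrite b1 /zipDr /w /= b0 b2 addr0.
(* The block 111 comes from 010, which comes in turn from the single entry 1. *)
apply/accP/Or43; exists (fun j => (j == 1%N)%:R).
  by apply/accP/Or42; exists (fun=> 1); [exact: acc1 | case=> [|[|[]]]].
by case=> [|[|[]]] //= _; rewrite ?b0 ?b1 ?b2 /zipDl /= ?add0r ?addr0.
Qed.

(** * Blocks of period three *)

Definition fibonacci (b : nat -> 'F_2) : Prop :=
  forall j, b j + b j.+1 = b j.+2.

(** The sequence has period 3 and any three consecutive entries sum to 0; the indices 2j, 2j + 2, 2j
    + 4 again cover all residues modulo 3. *)
Lemma fibonacci_double (b : nat -> 'F_2) :
  fibonacci b -> fibonacci (fun j => b j.*2).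
Proof.
move=> bE j; rewrite -[b j.+2.*2]bE -[b j.*2.+3]bE -[b j.+1.*2]/(b j.*2.+2) -bE.
by case: (F2P (b j.*2)) (F2P (b j.*2.+1)) => [] -> [] ->; apply: val_inj.
Qed.

Lemma fibonacci_shift3 (b : nat -> 'F_2) (j : nat) :
  fibonacci b -> b j.+3 = b j.
Proof. by move=> bE; rewrite -bE addrC -bE F2_addKr. Qed.

Lemma fibonacci_zipDr (b : nat -> 'F_2) : fibonacci b ->
  forall j, b j = zipDr (fun i => b i.*2) j.
Proof.
by move=> bE j; case: (parityP j) => i; rewrite zipE // doubleS -bE F2_addKl.
Qed.

(** Such a block is [zipDr] of its even-indexed entries, which form a shorter block of the same
    kind. *)
Lemma acc_fibonacci (m : nat) (b : nat -> 'F_2) : fibonacci b -> acc m b.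
Proof.
elim/ltn_ind: m b => m IHm b bE; have [m3|m3] := leqP m 3; first exact: acc_le3.
apply/accP/Or44; exists (fun j => b j.*2) => [|j _].
  by apply: IHm (fibonacci_double bE); lia.
exact: fibonacci_zipDr.
Qed.

Lemma acc_by_fibonacci (m : nat) (b : nat -> 'F_2) : fibonacci b ->
  acc_by zipDl (uphalf m).+1 m b /\ acc_by zipDr m./2.+1 m b.
Proof.
move=> bE; split.
  (* Position 2i + 1 then shows b(2i + 4) = b(2i + 1), and position 2i shows b(2i + 2) + b(2i + 4) =
     b(2i + 3) = b(2i). *)
  exists (fun i => b i.*2.+2) => [|j _].
    apply/acc_fibonacci/(@fibonacci_double (fun j => b j.+2)) => j.
    exact: bE.
  case: (parityP j) => i; rewrite zipE !doubleS fibonacci_shift3 //.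
  by rewrite -bE F2_addKr.
exists (fun i => b i.*2) => [|j _]; first exact/acc_fibonacci/fibonacci_double.
exact: fibonacci_zipDr.
Qed.

(** * Inaccessible blocks and the overlap of even and odd rows *)

Lemma not_acc_ones (m : nat) (b : nat -> 'F_2) : (3 < m)%N ->
  (forall j, (j < m)%N -> b j = 1) -> ~ acc m b.
Proof.
(* Four entries suffice: an even row puts a 0 among any two neighbours, and in an odd row some three
   consecutive ones are x, x + y, y, which cannot all be 1. *)
move=> m4 b1 /(acc_leq m4)/accP [] [w _ wE].
- by have := wE 1%N isT; rewrite b1 // ; lia.
- by have := wE 0%N isT; rewrite b1 //; lia.
- have := wE 1%N isT; have := wE 2 isT; have := wE 3 isT.
  rewrite !b1 ?/zipDl //=; try lia.
  by move=> <- + w1; rewrite -w1 => /(congr1 val).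
have := wE 0%N isT; have := wE 1%N isT; have := wE 2 isT.
rewrite !b1 ?/zipDr //=; try lia.
by move=> <- + w1; rewrite -w1 => /(congr1 val).
Qed.

(** The ends have opposite parity, so in an even row one of them is an inserted zero. In an odd row
    one end is a source entry 1 whose neighbour in the source is 0, and their sum 1 falls inside the
    gap. *)
Lemma not_acc_gap (m : nat) (b : nat -> 'F_2) : (3 < m)%N -> ~~ odd m ->
  b 0%N = 1 -> b m.-1 = 1 -> (forall j, (0 < j < m.-1)%N -> b j = 0) ->
  ~ acc m b.
Proof.
case: (parityP m) => -[|[|k]] //=; rewrite ?odd_double //= => k1 _ b0 bm bj.
case/accP=> -[w _ wE].
- have := wE k.+1.*2.+1 (ltnSn _); rewrite [LHS]bm zipE => /eqP.
  by rewrite oner_eq0.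
- by have /eqP := wE 0%N isT; rewrite b0 (zip0l_double _ 0) oner_eq0.
- have w2 : w k.+2 = 1 by rewrite -bm (wE k.+1.*2.+1) ?zipE //; lia.
  have w1 : w k.+1 = 0.
    by have := wE k.*2.+1; rewrite zipE bj => [->|]//; lia.
  have : b k.+1.*2 = 1 by rewrite wE ?zipE ?w1 ?w2 ?add0r //; lia.
  by rewrite bj => [/eqP|]; [rewrite eq_sym oner_eq0|lia].
have w0 : w 0%N = 1 by rewrite -b0 (wE 0%N).
have w1 : w 1%N = 0 by rewrite -[RHS](bj 2) ?(wE 2) //; lia.
have := wE 1%N isT; rewrite (zipDr_doubleS _ 0) w0 w1 bj; last by lia.
by rewrite addr0 => /eqP; rewrite eq_sym oner_eq0.
Qed.

Lemma ends_cases (m : nat) (b : nat -> 'F_2) : (1 < m)%N ->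
    (forall j, (0 < j < m.-1)%N -> b j = 0) -> b 0%N = 0 \/ b m.-1 = 0 ->
  [\/ forall j, (j < m)%N -> b j = 0,
      forall j, (j < m)%N -> b j = (j == 0%N)%:R |
      forall j, (j < m)%N -> b j = (j.+1 == m)%:R].
Proof.
move=> m1 bj ends.
have bE j : (j < m)%N ->
    b j = if j == 0%N then b 0%N else if j.+1 == m then b m.-1 else 0.
  move=> jm; case: eqP => [-> //|j0]; case: eqP => [jE|jm1].
    by congr b; lia.
  by apply: bj; lia.
case: (F2P (b 0%N)) (F2P (b m.-1)) => [] b0 [] bm.
- by apply: Or31 => j jm; rewrite bE // b0 bm !if_same.
- apply: Or33 => j jm; rewrite bE // b0 bm.
  have [j0|j0] := eqVneq j 0%N; last by case: eqP.
  by have -> : (j.+1 == m) = false by lia.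
- by apply: Or32 => j jm; rewrite bE // b0 bm if_same; case: eqP.
- by case: ends; rewrite ?b0 ?bm => /eqP; rewrite oner_eq0.
Qed.

(** The zeros forced by the even row act on the source [g] of the odd row: where they meet plain
    entries, [g] vanishes except possibly at one end; where they meet sums, [g] is constant. *)
Lemma acc_by_even_odd (m : nat) (b : nat -> 'F_2) : (5 < m)%N ->
    acc_by zip0r (uphalf m) m b \/ acc_by zip0l m./2 m b ->
    acc_by zipDl (uphalf m).+1 m b \/ acc_by zipDr m./2.+1 m b ->
  [\/ forall j, (j < m)%N -> b j = 0,
      forall j, (j < m)%N -> b j = (j == 0%N)%:R |
      forall j, (j < m)%N -> b j = (j.+1 == m)%:R].
Proof.
move=> m6 [] [w accw bw] [] [g accg bg].
- have g0 i : (0 < i <= m./2)%N -> g i = 0.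
    case: i => // i im; have := bg i.*2.+1; rewrite zipE => <-; last by lia.
    by rewrite bw ?zipE //; lia.
  have bj j : (0 < j < m.-1)%N -> b j = 0.
    case: (parityP j) => i im; last by rewrite bw ?zipE //; lia.
    by rewrite bg ?zipE ?g0 ?addr0 //; lia.
  apply: ends_cases => //; first by lia.
  case: (F2P (b 0%N)) => b0; [by left|right].
  case: (F2P (b m.-1)) => // bm; exfalso.
  case: (parityP m) m6 accw accg bw bg bm g0 bj
    => k k6 accw accg bw bg bm g0 bj.
    case: k k6 accw accg bw bg bm g0 bj => [//|k] k6 accw accg bw bg bm g0 bj.
    by move: bm; rewrite bw //= zipE => /eqP; rewrite eq_sym oner_eq0.
  (* Now m = 2k + 1, and the sources [w] and [g], of lengths k + 1 and k + 2, both have the form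
     10...01. [not_acc_gap] rejects the one of even length. *)
  have w0 : w 0%N = 1 by rewrite -b0 bw.
  have wk : w k = 1 by rewrite -bm bw //= zipE.
  have g00 : g 0%N = 1.
    by rewrite -b0 bg // (zipDl_double _ 0) (g0 1%N) ?addr0 //; lia.
  have gk : g k.+1 = 1 by rewrite -bm bg //= zipE (g0 k) ?add0r //; lia.
  move: accw accg; rewrite /= doubleK => accw accg.
  have [ok|ek] := boolP (odd k).
    apply: not_acc_gap accw => //=; try lia.
    by move=> j jk; have := bj j.*2; rewrite bw ?zipE; [apply; lia|lia].
  apply: not_acc_gap accg => //=; try lia.
  by move=> j jk; apply: g0; lia.
(* All sums vanish, so [g] is constant; as m >= 6 it has at least four entries, and [not_acc_ones]
   leaves only 0. *)
- have gE i : (i <= m./2)%N -> g i = g 0%N.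
    elim: i => // i IHi im; rewrite -IHi; last by lia.
    apply/esym/F2_add_eq0; have := bg i.*2.+1; rewrite zipE => <-; last by lia.
    by rewrite bw ?zipE //; lia.
  have [g0|g0] := F2P (g 0%N); last first.
    by case: (@not_acc_ones m./2.+1 g) => // [|j jm]; [lia|rewrite gE].
  apply: Or31 => j; case: (parityP j) => i im; last by rewrite bw ?zipE.
  by rewrite bg // zipE gE ?g0 //; lia.
- have gE i : (i <= uphalf m)%N -> g i = g 0%N.
    elim: i => // i IHi im; rewrite -IHi; last by lia.
    apply/esym/F2_add_eq0; have := bg i.*2; rewrite zipE => <-; last by lia.
    by rewrite bw ?zipE //; lia.
  have [g0|g0] := F2P (g 0%N); last first.
    by case: (@not_acc_ones (uphalf m).+1 g) => // [|j jm]; [lia|rewrite gE].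
  apply: Or31 => j; case: (parityP j) => i im; first by rewrite bw ?zipE.
  by rewrite bg // zipE gE ?g0 //; lia.
(* Only the source entry at m/2, for even m, escapes; it contributes to the last position of the
   block alone. *)
- have g0 i : (i < uphalf m)%N -> g i = 0.
    move=> im; have := bg i.*2; rewrite zipE => <-; last by lia.
    by rewrite bw ?zipE //; lia.
  apply: ends_cases; first by lia.
    move=> j; case: (parityP j) => i im; first by rewrite bw ?zipE //; lia.
    by rewrite bg ?zipE ?g0 ?addr0 //; lia.
  by left; rewrite bw ?(zip0l_double _ 0) //; lia.
Qed.

(** * Counting accessible blocks by inclusion-exclusion *)

Definition window (m : nat) (b : nat -> 'F_2) : m.-tuple 'F_2 :=
  [tuple b i | i < m].

Lemma nth_window (m : nat) (b : nat -> 'F_2) (j : nat) :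
  (j < m)%N -> (window m b)`_j = b j.
Proof. by move=> jm; rewrite -[j]/(val (Ordinal jm)) nth_mktuple. Qed.

Lemma tuple_window (m : nat) (t : m.-tuple 'F_2) (b : nat -> 'F_2) :
  (forall j, (j < m)%N -> t`_j = b j) -> t = window m b.
Proof.
move=> tb; apply/val_inj/(@eq_from_nth _ 0); rewrite !size_tuple // => j jm.
by rewrite nth_window ?tb.
Qed.

Lemma eq_window (m : nat) (b c : nat -> 'F_2) :
  (forall j, (j < m)%N -> b j = c j) <-> window m b = window m c.
Proof.
split=> [bc|bc j jm]; last by rewrite -(nth_window b jm) bc nth_window.
by apply: tuple_window => j jm; rewrite nth_window ?bc.
Qed.

Definition accset (m : nat) : {set m.-tuple 'F_2} :=
  [set b : m.-tuple 'F_2 | `[< acc m (nth 0 b) >]].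

Definition accset_by (op : (nat -> 'F_2) -> nat -> 'F_2) (n m : nat) :
    {set m.-tuple 'F_2} :=
  [set b : m.-tuple 'F_2 | `[< acc_by op n m (nth 0 b) >]].

Definition nb_trinom : nat -> nat := nb_accessible 2 (1 + 'X + 'X^2).

Lemma nb_trinomE (m : nat) : nb_trinom m = #|accset m|.
Proof.
congr #|pred_of_set _|; apply/setP => b; rewrite !inE.
by apply: asbool_equiv_eq; apply: accessibleE.
Qed.

Lemma window_accset (m : nat) (b : nat -> 'F_2) :
  (window m b \in accset m) <-> acc m b.
Proof.
rewrite inE; split=> [/asboolP|b_acc]; last apply/asboolP; last move: b_acc.
  by apply: acc_eq => j jm; rewrite nth_window.
by apply: acc_eq => j jm; rewrite nth_window.
Qed.

Lemma window_accset_by op (n m : nat) (b : nat -> 'F_2) :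
  acc_by op n m b -> window m b \in accset_by op n m.
Proof.
case=> w accw bw; rewrite inE; apply/asboolP; exists w => // j jm.
by rewrite nth_window ?bw.
Qed.

Lemma card_accset_by op (n m : nat) : equivalid op n m ->
  #|accset_by op n m| = #|accset n|.
Proof.
move=> opE.
have -> : accset_by op n m =
    [set window m (op (nth 0 (w : n.-tuple 'F_2))) | w in accset n].
  apply/setP => b; apply/idP/imsetP => [|[w]]; rewrite !inE.
    move=> /asboolP[w accw bw]; exists (window n w); first exact/window_accset.
    apply: tuple_window => j jm; rewrite bw //; apply: (opE _ _).1 => // i im.
    by rewrite nth_window.
  move=> /asboolP accw ->; apply/asboolP; exists (nth 0 w) => // j jm.
  by rewrite nth_window.
apply: card_in_imset => u v _ _ /eq_window/(opE _ _).2 uv.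
by apply/val_inj/(@eq_from_nth _ 0); rewrite !size_tuple.
Qed.

Lemma accsetE (m : nat) : accset m =
  (accset_by zip0r (uphalf m) m :|: accset_by zip0l m./2 m) :|:
  (accset_by zipDl (uphalf m).+1 m :|: accset_by zipDr m./2.+1 m).
Proof.
apply/setP => b; rewrite !inE; apply/asboolP/idP => [/accP[] h|].
- by rewrite (asboolT h).
- by rewrite (asboolT h) orbT.
- by rewrite (asboolT h) orbT.
- by rewrite (asboolT h) !orbT.
by move=> /orP[/orP[]|/orP[]] /asboolP h; apply/accP;
   [apply: Or41|apply: Or42|apply: Or43|apply: Or44].
Qed.

Lemma acc_by_zip0 (m : nat) (b : nat -> 'F_2) :
  acc_by zip0r (uphalf m) m b -> acc_by zip0l m./2 m b ->
  forall j, (j < m)%N -> b j = 0.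
Proof.
move=> [w _ bw] [v _ bv] j; case: (parityP j) => i im.
  by rewrite bv ?zipE.
by rewrite bw ?zipE.
Qed.

(** The [fibonacci] sequence with the pair [p] as its first two entries; the four pairs parametrize
    the overlap of the two odd-row constructions. *)
Definition fib2 (p : 'F_2 * 'F_2) (j : nat) : 'F_2 :=
  (iter j (fun q : 'F_2 * 'F_2 => (q.2, q.1 + q.2)) p).1.

Lemma fib2_rec p j : fib2 p j + fib2 p j.+1 = fib2 p j.+2.
Proof. by []. Qed.

(** The inserted zeros occupy complementary positions, so only the zero block is counted twice. *)
Lemma card_zip0U (m : nat) :
  (#|accset_by zip0r (uphalf m) m :|: accset_by zip0l m./2 m|).+1 =
  (#|accset (uphalf m)| + #|accset m./2|)%N.
Proof.
rewrite -(card_accset_by (@equivalid_zip0r m)).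
rewrite -(card_accset_by (@equivalid_zip0l m)).
rewrite -cardsUI (_ : _ :&: _ = [set window m (fun=> 0)]) ?cards1 ?addn1 //.
apply/setP => b; rewrite in_setI in_set1; apply/andP/eqP => [|->].
  rewrite !inE => -[/asboolP br /asboolP bl].
  by apply: tuple_window; apply: acc_by_zip0.
split; apply: window_accset_by; exists (fun=> 0); rewrite /zip0r /zip0l;
  by [exact: acc_zero | move=> j _; rewrite if_same].
Qed.

(** In a common block, [zipDr] makes three consecutive entries sum to 0 from even positions on,
    [zipDl] from odd ones. The overlap is thus the four [fib2] blocks, distinct since m > 1. *)
Lemma card_zipDU (m : nat) : (1 < m)%N ->
  (#|accset_by zipDl (uphalf m).+1 m :|: accset_by zipDr m./2.+1 m| + 4 =
  #|accset (uphalf m).+1| + #|accset m./2.+1|)%N.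
Proof.
move=> m1; rewrite -(card_accset_by (equivalid_zipDl m1)).
rewrite -(card_accset_by (equivalid_zipDr (ltnW m1))).
rewrite -cardsUI; congr (_ + _)%N; symmetry.
rewrite (_ : _ :&: _ = [set window m (fib2 p) | p in [set: 'F_2 * 'F_2]]).
  rewrite card_imset ?cardsT ?card_prod ?card_Fp //.
  move=> [a c] [a' c'] /eq_window E; congr pair; first exact: (E 0%N (ltnW m1)).
  exact: (E 1%N m1).
apply/setP => b; rewrite in_setI; apply/andP/imsetP => [|[p _ ->]].
  rewrite !inE => -[/asboolP [u _ bu] /asboolP [v _ bv]].
  exists (b`_0, b`_1) => //; apply: tuple_window.
  have bD j : (j.+2 < m)%N -> b`_j.+2 = b`_j + b`_j.+1.
    move=> jm; case: (parityP j) jm => i im.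
      by rewrite -[i.*2.+2]/(i.+1.*2) !bv ?zipE ?F2_addKl //; lia.
    rewrite -[i.*2.+3]/(i.+1.*2.+1) -[i.*2.+2]/(i.+1.*2).
    by rewrite !bu ?zipE ?F2_addKl //; lia.
  elim/ltn_ind=> -[|[|j]] IHj jm //.
  by rewrite bD // -fib2_rec (IHj j) ?(IHj j.+1) //; lia.
have [? ?] := acc_by_fibonacci m (@fib2_rec p).
by split; apply: window_accset_by.
Qed.

Lemma accset_even_odd (m : nat) : (5 < m)%N ->
  #|(accset_by zip0r (uphalf m) m :|: accset_by zip0l m./2 m) :&:
    (accset_by zipDl (uphalf m).+1 m :|: accset_by zipDr m./2.+1 m)| = 3.
Proof.
move=> m6; set E := _ :&: _.
pose e0 := window m (fun=> 0).
pose e1 := window m (fun j => (j == 0%N)%:R).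
pose e2 := window m (fun j => (j.+1 == m)%:R).
have -> : E = [set e0; e1; e2].
  apply/eqP; rewrite eqEsubset; apply/andP; split; apply/subsetP => b.
    rewrite !inE => /andP[/orP h0 /orP hD].
    have [||bE|bE|bE] := @acc_by_even_odd m (nth 0 b) m6.
    - by case: h0 => /asboolP; [left|right].
    - by case: hD => /asboolP; [left|right].
    - by rewrite (tuple_window bE) eqxx.
    - by rewrite (tuple_window bE) eqxx orbT.
    - by rewrite (tuple_window bE) eqxx !orbT.
  move=> /setUP[/set2P[]|/set1P] ->.
  - apply/setIP; split; apply/setUP; left; apply: window_accset_by;
      exists (fun=> 0) => [|j _]; try exact: acc_zero.
      by rewrite /zip0r if_same.
    by rewrite /zipDl addr0 if_same.
  - apply/setIP; split; apply/setUP; left; apply: window_accset_by;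
      exists (fun j => (j == 0%N)%:R) => [|j _]; try exact: acc_first.
      by case: (parityP j) => i; rewrite zipE //; congr (_%:R); lia.
    by case: (parityP j) => i; rewrite zipE //= ?addr0; congr (_%:R); lia.
  have accl := acc_last.
  (* The final 1 must be a source entry in the even row and a sum in the odd row; the parity of m -
     1 decides which pair of constructions allows this. *)
  have [om|em] := boolP (odd m).
    apply/setIP; split; apply/setUP; left; apply: window_accset_by.
      exists (fun j => (j.+1 == uphalf m)%:R) => // j jm.
      case: (parityP j) jm => i im; rewrite zipE; first by congr (_%:R); lia.
      by have -> : (i.*2.+2 == m) = false by lia.
    exists (fun j => (j.+1 == (uphalf m).+1)%:R) => // j jm.
    case: (parityP j) jm => i im; rewrite zipE; last by congr (_%:R); lia.
    have -> : (i.+1 == (uphalf m).+1) = false by lia.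
    by rewrite add0r; congr (_%:R); lia.
  apply/setIP; split; apply/setUP; right; apply: window_accset_by.
    exists (fun j => (j.+1 == m./2)%:R) => // j jm.
    case: (parityP j) jm => i im; rewrite zipE; last by congr (_%:R); lia.
    by have -> : (i.*2.+1 == m) = false by lia.
  exists (fun j => (j.+1 == m./2.+1)%:R) => // j jm.
  case: (parityP j) jm => i im; rewrite zipE.
    by congr (_%:R); lia.
  have -> : (i.+1 == m./2.+1) = false by lia.
  by rewrite add0r; congr (_%:R); lia.
have e01 : e0 != e1.
  apply/eqP => /eq_window/(_ 0%N) /(_ ltac:(lia)) /eqP.
  by rewrite eq_sym oner_eq0.
have e02 : e0 != e2.
  apply/eqP => /eq_window/(_ m.-1) /(_ ltac:(lia)) /eqP.
  by rewrite prednK ?eqxx 1?eq_sym ?oner_eq0 //; lia.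
have e12 : e1 != e2.
  apply/eqP => /eq_window/(_ 0%N) /(_ ltac:(lia)) /eqP.
  by rewrite (_ : (1%N == m) = false) ?oner_eq0 //; lia.
rewrite setUC cardsU1 cards2 !inE e01.
by rewrite eq_sym (negbTE e02) eq_sym (negbTE e12).
Qed.

(** Here 8 = 1 + 4 + 3: the overlaps within even rows, within odd rows, and between the two. *)
Lemma nb_trinom_rec (m : nat) : (5 < m)%N ->
  (nb_trinom m + 8 = nb_trinom (uphalf m) + nb_trinom m./2 +
    nb_trinom (uphalf m).+1 + nb_trinom m./2.+1)%N.
Proof.
move=> m6; rewrite !nb_trinomE.
have := card_zip0U m; have := @card_zipDU m ltac:(lia).
have := accset_even_odd m6; rewrite (accsetE m).
have := cardsUI (accset_by zip0r (uphalf m) m :|: accset_by zip0l m./2 m)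
  (accset_by zipDl (uphalf m).+1 m :|: accset_by zipDr m./2.+1 m).
by move=> *; lia.
Qed.

(** * Initial values, to which the recursion does not apply *)

Fixpoint words (T : Type) (s : seq T) (n : nat) : seq (seq T) :=
  if n is n'.+1 then [seq x :: w | x <- s, w <- words s n'] else [:: [::]].

Lemma mem_words (T : finType) (s : seq T) (n : nat) (w : seq T) :
  (forall x, x \in s) -> (w \in words s n) = (size w == n).
Proof.
move=> sT; elim: n w => [|n IHn] [|x w] //=.
  by apply/negP => /allpairsP[[y v] []].
rewrite eqSS -IHn; apply/allpairsP/idP => [[[y v] [_ vn [_ ->]]] //|wn].
by exists (x, w).
Qed.

Lemma uniq_words (T : finType) (s : seq T) (n : nat) :
  uniq s -> uniq (words s n).
Proof.
move=> us; elim: n => //= n IHn; apply: allpairs_uniq => //.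
by move=> [x v] [y w] _ _ [-> ->].
Qed.

(** Replaces a cardinality by a count over an explicit list, which can be evaluated by
    computation. *)
Lemma card_set_tuple (T : finType) (s : seq T) (n : nat) (P : pred (seq T)) :
    uniq s -> (forall x, x \in s) ->
  #|[set b : n.-tuple T | P b]| = count P (words s n).
Proof.
move=> us sT; rewrite cardsE cardE /enum_mem size_filter.
have /permP/(_ P) : perm_eq [seq val b | b : n.-tuple T] (words s n).
  apply: uniq_perm; rewrite ?uniq_words //.
    by rewrite map_inj_uniq ?enum_uniq //; apply: val_inj.
  move=> w; rewrite mem_words //; apply/mapP/idP => [[b _ ->]|/eqP wn].
    by rewrite size_tuple.
  by exists (Tuple (introT eqP wn)) => //; rewrite mem_enum.
by rewrite count_map => <-; rewrite enumT; apply: eq_count => b; rewrite !inE.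
Qed.

(** The four alternatives of [accP] at length 4. All sources have length at most 3, hence are
    accessible, and only the linear relations remain. *)
Definition acc4 (b : nat -> 'F_2) : bool :=
  [|| (b 1 == 0) && (b 3 == 0), (b 0 == 0) && (b 2 == 0),
      b 2 == b 1 + b 3 | b 1 == b 0 + b 2].

(** As [acc4], but the [zipDl] source now has length 4; it is rebuilt from [b] and tested by
    [acc4]. *)
Definition acc5 (b : nat -> 'F_2) : bool :=
  [|| (b 1 == 0) && (b 3 == 0), [&& b 0 == 0, b 2 == 0 & b 4 == 0],
      (b 2 == b 1 + b 3) &&
        acc4 (nth 0 [:: b 0 + b 1; b 1; b 3; b 3 + b 4])
    | (b 1 == b 0 + b 2) && (b 3 == b 2 + b 4)].

Lemma acc4P (b : nat -> 'F_2) : acc 4 b <-> acc4 b.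
Proof.
split=> [/accP[] [w _ bw]|
  /or4P[/andP[/eqP b1 /eqP b3]|/andP[/eqP b0 /eqP b2]|/eqP b2|/eqP b1]].
- by rewrite /acc4 !bw.
- by rewrite /acc4 !bw //= orbT.
- by rewrite /acc4 !bw //= /zipDl /= eqxx !orbT.
- by rewrite /acc4 !bw //= /zipDr /= eqxx !orbT.
- apply/accP/Or41; exists (fun i => b i.*2); first exact: acc_le3.
  by case=> [|[|[|[]]]].
- apply/accP/Or42; exists (fun i => b i.*2.+1); first exact: acc_le3.
  by case=> [|[|[|[]]]].
- apply/accP/Or43; exists (nth 0 [:: b 0 + b 1; b 1; b 3]).
    exact: acc_le3.
  by case=> [|[|[|[]]]] //= _; rewrite /zipDl /= ?F2_addKr.
apply/accP/Or44; exists (nth 0 [:: b 0; b 2; b 2 + b 3]); first exact: acc_le3.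
by case=> [|[|[|[]]]] //= _; rewrite /zipDr /= ?F2_addKl.
Qed.

Lemma acc5P (b : nat -> 'F_2) : acc 5 b <-> acc5 b.
Proof.
split=> [/accP[] [w accw bw]|
  /or4P[/andP[/eqP b1 /eqP b3]|/and3P[/eqP b0 /eqP b2 /eqP b4]|
    /andP[/eqP b2 /acc4P acc_b]|/andP[/eqP b1 /eqP b3]]].
- by rewrite /acc5 !bw.
- by rewrite /acc5 !bw //= orbT.
- apply/or4P/Or43; rewrite !bw // /zipDl /= eqxx /=; apply/acc4P.
  apply: acc_eq accw; case=> [|[|[|[]]]] //= _; by rewrite ?F2_addKr ?F2_addKl.
- by rewrite /acc5 !bw //= /zipDr /= !eqxx !orbT.
- apply/accP/Or41; exists (fun i => b i.*2); first exact: acc_le3.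
  by case=> [|[|[|[|[]]]]].
- apply/accP/Or42; exists (fun i => b i.*2.+1); first exact: acc_le3.
  by case=> [|[|[|[|[]]]]].
- apply/accP/Or43; eexists; first exact: acc_b.
  by case=> [|[|[|[|[]]]]] //= _; rewrite /zipDl /= ?F2_addKr ?F2_addKl.
apply/accP/Or44; exists (fun i => b i.*2); first exact: acc_le3.
by case=> [|[|[|[|[]]]]].
Qed.

Lemma card_accset_dec (m : nat) (P : (nat -> 'F_2) -> bool) :
    (forall b, acc m b <-> P b) ->
  #|accset m| = count (fun s => P (nth 0 s)) (words [:: 0; 1] m).
Proof.
move=> accE; rewrite -card_set_tuple // => [|x].
  by apply: eq_card => b; rewrite !inE; apply/asboolP/idP => /accE.
by case: (F2P x) => ->.
Qed.

Lemma nb_trinom_le3 (m : nat) : (m <= 3)%N -> nb_trinom m = (2 ^ m)%N.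
Proof.
move=> m3; rewrite nb_trinomE -[2%N in RHS](card_Fp (isT : prime 2)).
rewrite -card_tuple -cardsT.
by apply: eq_card => b; rewrite !inE; apply/asboolT/acc_le3.
Qed.

Lemma nb_trinom4 : nb_trinom 4 = 14.
Proof. by rewrite nb_trinomE (card_accset_dec acc4P); vm_compute. Qed.

Lemma nb_trinom5 : nb_trinom 5 = 25.
Proof. by rewrite nb_trinomE (card_accset_dec acc5P); vm_compute. Qed.

(** * Coefficients of power series and of the sum over powers of two *)

Lemma fps_coefXnM (R : comNzRingType) (k : nat) (f : fps R) (n : nat) :
  (fps_z R ^+ k * f) n = if (n < k)%N then 0 else f (n - k)%N.
Proof.
rewrite fps_coefM; case: ltnP => nk.
  rewrite big1 // => i _; rewrite fps_coefXn ltn_eqF ?mul0r //.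
  exact: leq_ltn_trans (leq_ord i) nk.
have kn : (k < n.+1)%N by [].
rewrite (bigD1 (Ordinal kn)) //= fps_coefXn eqxx mul1r big1 ?addr0 // => i ik.
by rewrite fps_coefXn -[(i : nat) == k]/(i == Ordinal kn) (negbTE ik) mul0r.
Qed.

Lemma fps_coefD (R : comNzRingType) (f g : fps R) n : (f + g) n = f n + g n.
Proof. by []. Qed.
Lemma fps_coefN (R : comNzRingType) (f : fps R) n : (- f) n = - f n.
Proof. by []. Qed.

Definition pow2_series : fps int :=
  fps_sum (fun i => fps_z int ^+ (2 ^ i) - fps_z int ^+ (3 * 2 ^ i)).

Lemma pow2_seriesE (n N : nat) : (n < N)%N -> pow2_series n =
  \sum_(i < N) ((n == (2 ^ i)%N)%:R - (n == (3 * 2 ^ i)%N)%:R).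
Proof.
move=> nN; rewrite /pow2_series (@fps_sumE _ _ _ N) => [|i Ni].
  by apply: eq_bigr => i _; rewrite fps_coefD fps_coefN !fps_coefXn.
have := ltn_expl i (isT : 1 < 2)%N => iE.
by rewrite fps_coefD fps_coefN !fps_coefXn !ltn_eqF ?subrr //; lia.
Qed.

Lemma pow2_series_double (n : nat) : (0 < n)%N ->
  pow2_series n.*2 = pow2_series n.
Proof.
move=> n0; rewrite (@pow2_seriesE _ n.*2.+1) //.
(* This bound leaves equally many terms on both sides once term 0, with its odd exponents 1 and 3,
   is dropped on the left; term i + 1 at 2n is then term i at n. *)
rewrite (@pow2_seriesE n n.*2); last by lia.
rewrite big_ord_recl.
have -> : (n.*2 == (2 ^ (@ord0 n.*2))%N) = false by rewrite expn0; lia.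
have -> : (n.*2 == (3 * 2 ^ (@ord0 n.*2))%N) = false by rewrite expn0; lia.
rewrite subr0 add0r; apply: eq_bigr => i _; rewrite /= /bump add1n expnS.
by congr (_%:R - _%:R); congr nat_of_bool; lia.
Qed.

Lemma pow2_series_odd (n : nat) : odd n -> (3 < n)%N -> pow2_series n = 0.
Proof.
move=> on n3; rewrite (@pow2_seriesE _ n.+1) // big1 // => -[[|i] iP] _ /=.
  by rewrite expn0; case: eqP => [|_]; [lia|]; case: eqP => [|_]; [lia|].
rewrite !expnS; have -> : (n == (2 * 2 ^ i)%N) = false by lia.
by have -> : (n == (3 * (2 * 2 ^ i))%N) = false by lia.
Qed.

Lemma pow2_series0 : pow2_series 0 = 0.
Proof. by rewrite (@pow2_seriesE 0 1) // big_ord1. Qed.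

Lemma pow2_series1 : pow2_series 1 = 1.
Proof. by rewrite (@pow2_seriesE 1 2) // !big_ord_recl big_ord0. Qed.

Lemma pow2_series3 : pow2_series 3 = -1.
Proof. by rewrite (@pow2_seriesE 3 4) // !big_ord_recl big_ord0. Qed.

(** * The linear recurrence and the generating function *)

Lemma nb_trinom_double (k : nat) : (2 < k)%N ->
  (nb_trinom k.*2 + 8 = 2 * nb_trinom k + 2 * nb_trinom k.+1)%N.
Proof.
move=> k2; rewrite nb_trinom_rec; last by lia.
by rewrite uphalf_double doubleK; lia.
Qed.

Lemma nb_trinom_doubleS (k : nat) : (2 < k)%N ->
  (nb_trinom k.*2.+1 + 8 = nb_trinom k + 2 * nb_trinom k.+1 + nb_trinom k.+2)%N.
Proof.
move=> k2; rewrite nb_trinom_rec; last by lia.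
by rewrite /= uphalf_double doubleK; lia.
Qed.

(** Coefficient of z^(n+4) in the identity cleared of its denominator: the terms at n = 1 and n = 2
    come from 2z^5 and -z^6. *)
Lemma nb_trinom_lin (n : nat) :
  (nb_trinom n.+4)%:Z - (2 * nb_trinom n.+3)%:Z + (2 * nb_trinom n.+1)%:Z
    - (nb_trinom n)%:Z =
  2 * (n == 1%N)%:R - (n == 2%N)%:R + pow2_series n.+1.
Proof.
(* From n = 6 on, k = n/2 rounded down is at least 3, so the halving recursions apply; smaller n
   need the values up to a(9). *)
elim/ltn_ind: n => n IHn; have [n6|n6] := ltnP n 6.
  have a6 : (nb_trinom 6 + 8 = _)%N := nb_trinom_double (isT : 2 < 3)%N.
  have a7 : (nb_trinom 7 + 8 = _)%N := nb_trinom_doubleS (isT : 2 < 3)%N.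
  have a8 : (nb_trinom 8 + 8 = _)%N := nb_trinom_double (isT : 2 < 4)%N.
  have a9 : (nb_trinom 9 + 8 = _)%N := nb_trinom_doubleS (isT : 2 < 4)%N.
  have a0 := @nb_trinom_le3 0 isT; have a1 := @nb_trinom_le3 1 isT.
  have a2 := @nb_trinom_le3 2 isT; have a3 := @nb_trinom_le3 3 isT.
  have a4 := nb_trinom4; have a5 := nb_trinom5.
  have s2 : pow2_series 2 = _ := @pow2_series_double 1 isT.
  have s4 : pow2_series 4 = _ := @pow2_series_double 2 isT.
  have s6 : pow2_series 6 = _ := @pow2_series_double 3 isT.
  have {}a6 : nb_trinom 6 = 36 by lia.
  have {}a7 : nb_trinom 7 = 53 by lia.
  have {}a8 : nb_trinom 8 = 70 by lia.
  have {}a9 : nb_trinom 9 = 92 by lia.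
  move: n n6 {IHn} => [|[|[|[|[|[|//]]]]]] _.
  - by rewrite a4 a3 a1 a0 pow2_series1.
  - by rewrite a5 a4 a2 a1 s2 pow2_series1.
  - by rewrite a6 a5 a3 a2 pow2_series3.
  - by rewrite a7 a6 a4 a3 s4 s2 pow2_series1.
  - by rewrite a8 a7 a5 a4 pow2_series_odd.
  - by rewrite a9 a8 a6 a5 s6 pow2_series3.
have -> : (n == 1%N) = false by lia.
have -> : (n == 2) = false by lia.
rewrite mulr0 subr0 add0r; case: (parityP n) IHn n6 => k IHk k6.
  (* For n = 2k the recursions cancel the left side entirely; for n = 2k + 1, below, they turn it
     into the same expression at k. *)
  rewrite pow2_series_odd /= ?odd_double //; last by lia.
  have := @nb_trinom_double k.+2; have := @nb_trinom_doubleS k.+1.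
  have := @nb_trinom_doubleS k; have := @nb_trinom_double k.
  by rewrite !doubleS; clear IHk; lia.
have := @nb_trinom_double k.+2; have := @nb_trinom_doubleS k.+2.
have := @nb_trinom_doubleS k; have := @nb_trinom_double k.+1.
rewrite -[k.*2.+2]/(k.+1.*2) pow2_series_double //.
have := IHk k ltac:(lia).
have -> : (k == 1%N) = false by lia.
have -> : (k == 2) = false by lia.
rewrite mulr0 subr0 add0r => <-.
by rewrite !doubleS; clear IHk; lia.
Qed.

Theorem theorem2p10 :
  let a : nat -> nat := nb_accessible 2 (1 + 'X + 'X^2) in
  let z : fps int := fps_z int in
  Fps (fun n : nat => (a n)%:Z) =
    (1 + 2%:R * z ^+ 3 + 2%:R * z ^+ 5 - z ^+ 6
       + z ^+ 3 * fps_sum (fun i : nat => z ^+ (2 ^ i) - z ^+ (3 * 2 ^ i)))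
    / ((1 - z ^+ 2) * (1 - z) ^+ 2).
Proof.
move=> a z; set F := Fps _; rewrite -/pow2_series.
have FE n : F n = (nb_trinom n)%:Z by [].
(* The denominator is written as signed powers of z, with each factor 2 as a repeated term, so that
   [fps_coefXnM] applies termwise. Its constant coefficient 1 makes it a unit. *)
have denE : (1 - z ^+ 2) * (1 - z) ^+ 2 =
    1 - (z ^+ 1 + z ^+ 1) + (z ^+ 3 + z ^+ 3) - z ^+ 4 by ring.
apply: (canRL (mulrK _)).
  by rewrite denE fps_unitE !(fps_coefD, fps_coefN, fps_coefXn).
rewrite denE mulrC mulrBl mulrDl mulrBl mul1r !(mulrDl _ _ F).
rewrite !mulr_natl !mulr2n.
have one n : (1 : fps int) n = (n == 0%N)%:R by [].
apply: fpsP => n.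
rewrite !(fps_coefD, fps_coefN, fps_coefXnM, fps_coefXn, FE, one).
(* Degrees up to 3 involve only a(0) to a(3); higher ones are [nb_trinom_lin]. *)
case: n => [|[|[|[|n]]]].
- by rewrite nb_trinom_le3.
- by rewrite !nb_trinom_le3.
- by rewrite !nb_trinom_le3.
- by rewrite subnn pow2_series0 !nb_trinom_le3.
have := nb_trinom_lin n; rewrite !subSS !subn0 !eqSS => E.
apply: etrans (etrans _ E) _.
  by rewrite !PoszM; ring.
by move: pow2_series => S /=; ring.
Qed.
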